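(* Let $\mathbf{C}$ be one of the categories $\mathbf{VL}_{\mathrm{IPLH}}$, $\mathbf{VL}_{\mathrm{LH}}$, $\mathbf{VS}$, and let $\bigl((E_i)_{i\in I},(\varphi_{ji})_{i,j\in I,\,j\geq i}\bigr)$ be a direct system in $\mathbf{C}$. Then it has a direct limit in $\mathbf{C}$. If $\bigl(E,(\varphi_i)_{i\in I}\bigr)$ is any direct limit of the system in $\mathbf{C}$, then $E=\bigcup_{i}\varphi_i(E_i)$, $\varphi_i(E_i)\subseteq\varphi_j(E_j)$ whenever $i\leq j$, and: - if $\mathbf{C}=\mathbf{VL}_{\mathrm{IPLH}}$, then the $\varphi_i(E_i)$ are ideals in $E$; - if $\mathbf{C}=\mathbf{VL}_{\mathrm{LH}}$, then the $\varphi_i(E_i)$ are vector sublattices of $E$; - if $\mathbf{C}=\mathbf{VS}$, then the $\varphi_i(E_i)$ are linear subspaces of $E$. Furthermore, $\bigl(E,(\varphi_i)_{i\in I}\bigr)$ is also a direct limit of $\bigl((E_i),(\varphi_{ji})_{j\geq i}\bigr)$ in every category to the right of $\mathbf{C}$ in the chain $$\mathbf{VL}_{\mathrm{IPLH}}\subset\mathbf{VL}_{\mathrm{LH}}\subset\mathbf{POVS}_{\mathrm{Pos}}\to\mathbf{VS}\to\mathbf{Set}.$$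
   Context: All vector spaces are real. Vector lattices need not be Archimedean. A lattice homomorphism is a vector lattice homomorphism (a linear map preserving the lattice operations). A linear map $\varphi\colon E\to F$ between vector lattices is interval preserving if it is positive and $\varphi([0,x])=[0,\varphi(x)]$ for all $x\in E^+$. A preordered vector space is a vector space with a linear preorder induced by a wedge (not necessarily a cone, not necessarily generating). Categories: $\mathbf{VL}_{\mathrm{IPLH}}$: vector lattices and interval preserving lattice homomorphisms. $\mathbf{VL}_{\mathrm{LH}}$: vector lattices and lattice homomorphisms. $\mathbf{POVS}_{\mathrm{Pos}}$: preordered vector spaces and positive linear maps. $\mathbf{VS}$: vector spaces and linear maps. $\mathbf{Set}$: sets and arbitrary maps. In the chain, the inclusions are subcategory inclusions and the arrows are the obvious forgetful functors; ''is also a direct limit in a category to the right'' means that the image of the limit under the appropriate composition of inclusion/forgetful functors is a direct limit of the image of the system. Direct systems and limits in a category: let $I$ be a non-empty directed set. A direct system over $I$ consists of objects $O_i$ ($i\in I$) and morphisms $\varphi_{ji}\colon O_i\to O_j$ for $j\geq i$ such that $\varphi_{ii}$ is the identity and $\varphi_{kj}\circ\varphi_{ji}=\varphi_{ki}$ for $i\leq j\leq k$. A system $(O,(\varphi_i))$ of an object $O$ and morphisms $\varphi_i\colon O_i\to O$ is compatible if $\varphi_j\circ\varphi_{ji}=\varphi_i$ for all $j\geq i$. A direct limit is a compatible system $(O,(\varphi_i))$ such that, for every compatible system $(O',(\varphi_i'))$, there is a unique morphism $\chi\colon O\to O'$ with $\varphi_i'=\chi\circ\varphi_i$ for all $i$.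 *)

(* Defs.v *)
From HB Require Import structures.
From mathcomp Require Import all_boot all_order all_algebra.
From mathcomp Require Import boolp classical_sets set_interval reals.

Set Implicit Arguments.
Unset Strict Implicit.
Unset Printing Implicit Defensive.

Import Order.TTheory GRing.Theory Num.Theory.

Local Open Scope classical_set_scope.
Local Open Scope ring_scope.

(* Hierarchy Builder rejects a new join of MathComp's order structures with its
   algebraic structures, because the numeric structures already are such joins.
   The order on a vector space is hence introduced by mixins of its own, and the
   types are then made canonical instances of the order structures of the
   library, over [ring_display] in order to have [<=] in ring_scope (a display
   has no mathematical content). *)
HB.mixin Record Lmodule_isPreordered (R : realType) V of GRing.Lmodule R V := {
  lev : rel V;
  lev_refl : reflexive lev;
  lev_trans : transitive lev;
  lev_wD2r : forall z x y, lev x y -> lev (x + z) (y + z);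
  lev_wZ2l : forall (a : R) x y, 0 <= a -> lev x y -> lev (a *: x) (a *: y);
}.

(* The preorder is the one induced by the wedge [set x | 0 <= x], which need be
   neither a cone nor generating. *)
#[short(type="preorderedVectType")]
HB.structure Definition PreorderedVect (R : realType) :=
  { V of GRing.Lmodule R V & Lmodule_isPreordered R V }.

HB.mixin Record PreorderedVect_isLattice (R : realType) V
    of PreorderedVect R V := {
  lev_anti : antisymmetric (lev : rel V);
  meetv : V -> V -> V;
  joinv : V -> V -> V;
  lev_meet : forall x y z : V, lev x (meetv y z) = lev x y && lev x z;
  lev_join : forall x y z : V, lev (joinv x y) z = lev x z && lev y z;
}.

#[short(type="vectorLatticeType")]
HB.structure Definition VectorLattice (R : realType) :=
  { V of PreorderedVect R V & PreorderedVect_isLattice R V }.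

HB.instance Definition _ (R : realType) (V : preorderedVectType R) :=
  Order.Le_isPreorder.Build ring_display (V : Type)
    (@lev_refl R V) (@lev_trans R V).
HB.instance Definition _ (R : realType) (V : vectorLatticeType R) :=
  Order.Le_isPreorder.Build ring_display (V : Type)
    (@lev_refl R V) (@lev_trans R V).
HB.instance Definition _ (R : realType) (V : vectorLatticeType R) :=
  Order.Preorder_isPOrder.Build ring_display (V : Type) (@lev_anti R V).
HB.instance Definition _ (R : realType) (V : vectorLatticeType R) :=
  Order.POrder_MeetJoin_isLattice.Build ring_display (V : Type)
    (@lev_meet R V) (@lev_join R V).

Section Maps.
Variable R : realType.

Definition positive_linear (E F : preorderedVectType R) (f : E -> F) : Prop :=
  linear f /\ forall x : E, (0 : E) <= x -> (0 : F) <= f x.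

Definition lattice_hom (E F : vectorLatticeType R) (f : E -> F) : Prop :=
  [/\ linear f, Order.meet_morphism f & Order.join_morphism f].

Definition interval_preserving (E F : vectorLatticeType R) (f : E -> F) : Prop :=
  positive_linear f /\
  forall x : E, 0 <= x -> f @` `[0, x]%classic = `[0, f x]%classic.

Definition iplh (E F : vectorLatticeType R) (f : E -> F) : Prop :=
  lattice_hom f /\ interval_preserving f.

Lemma linear_map_id (E : lmodType R) : linear (@id E).
Proof. by []. Qed.

Lemma linear_map_comp (E F G : lmodType R) (g : F -> G) (f : E -> F) :
  linear g -> linear f -> linear (g \o f).
Proof. by move=> lg lf a x y /=; rewrite lf lg. Qed.

Lemma positive_linear_id (E : preorderedVectType R) :
  positive_linear (@id E).
Proof. by []. Qed.

Lemma positive_linear_comp (E F G : preorderedVectType R)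
    (g : F -> G) (f : E -> F) :
  positive_linear g -> positive_linear f -> positive_linear (g \o f).
Proof.
move=> [lg pg] [lf pf]; split; first exact: linear_map_comp.
by move=> x x0 /=; apply/pg/pf.
Qed.

Lemma lattice_hom_id (E : vectorLatticeType R) : lattice_hom (@id E).
Proof. by []. Qed.

Lemma lattice_hom_comp (E F G : vectorLatticeType R)
    (g : F -> G) (f : E -> F) :
  lattice_hom g -> lattice_hom f -> lattice_hom (g \o f).
Proof.
move=> [lg mg jg] [lf mf jf]; split.
- exact: linear_map_comp.
- by move=> x y /=; rewrite mf mg.
- by move=> x y /=; rewrite jf jg.
Qed.

Lemma iplh_id (E : vectorLatticeType R) : iplh (@id E).
Proof. by split=> //; split=> // x _; rewrite image_id. Qed.

Lemma iplh_comp (E F G : vectorLatticeType R) (g : F -> G) (f : E -> F) :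
  iplh g -> iplh f -> iplh (g \o f).
Proof.
move=> [hg [pg ig]] [hf [pf jf]]; split; first exact: lattice_hom_comp.
split; first exact: positive_linear_comp.
by move=> x x0; rewrite -image_comp jf ?ig//; apply: pf.2.
Qed.

Lemma linear_map0 (E F : lmodType R) (f : E -> F) : linear f -> f 0 = 0.
Proof.
by move=> lf; rewrite -[X in f X](subrr 0) -scaleN1r addrC lf scaleN1r addNr.
Qed.

Lemma lattice_hom_positive (E F : vectorLatticeType R) (f : E -> F) :
  lattice_hom f -> positive_linear f.
Proof.
move=> [lf _ jf]; split=> // x x0.
by rewrite -(linear_map0 lf) leEjoin -jf join_r.
Qed.

End Maps.

Section Subsets.
Variable R : realType.

Definition linear_subspace (E : lmodType R) (A : set E) : Prop :=
  GRing.submod_closed (mem A).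

Definition vector_sublattice (E : vectorLatticeType R) (A : set E) : Prop :=
  [/\ linear_subspace A, Order.ClosedPredicates.meet_closed (mem A)
    & Order.ClosedPredicates.join_closed (mem A)].

Definition vl_modulus (E : vectorLatticeType R) (x : E) : E := Order.join x (- x).

Definition lattice_ideal (E : vectorLatticeType R) (A : set E) : Prop :=
  linear_subspace A /\
  forall x y : E, A y -> vl_modulus x <= vl_modulus y -> A x.

End Subsets.

Local Obligation Tactic := idtac.

Lemma sval_inj T (P : T -> Prop) : injective (@sval T P).
Proof. by move=> [x Px] [y Py] /= xy; apply: eq_exist. Qed.

Record category := Category {
  obj : Type;
  mor : obj -> obj -> Type;
  mid : forall A, mor A A;
  mcomp : forall A B C, mor B C -> mor A B -> mor A C;
  mcomp1m : forall A B (f : mor A B), mcomp (mid B) f = f;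
  mcompm1 : forall A B (f : mor A B), mcomp f (mid A) = f;
  mcompA : forall A B C D (h : mor C D) (g : mor B C) (f : mor A B),
    mcomp h (mcomp g f) = mcomp (mcomp h g) f }.
Arguments mid {c} A.
Arguments mcomp {c A B C} g f : rename.

Record functor (C D : category) := Functor {
  fobj : obj C -> obj D;
  fmap : forall A B, mor A B -> mor (fobj A) (fobj B);
  fmap1 : forall A, fmap (mid A) = mid (fobj A);
  fmapM : forall A B E (g : mor B E) (f : mor A B),
    fmap (mcomp g f) = mcomp (fmap g) (fmap f) }.
Arguments fobj {C D} F A : rename.
Arguments fmap {C D} F {A B} f : rename.

Program Definition comp_functor (C D E : category)
    (G : functor D E) (F : functor C D) : functor C E :=
  @Functor C E (fun A => fobj G (fobj F A))
    (fun A B f => fmap G (fmap F f)) _ _.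
Next Obligation. by move=> C D E G F A /=; rewrite !fmap1. Qed.
Next Obligation. by move=> C D E G F A B A' g f /=; rewrite !fmapM. Qed.

Definition directed_set d (I : preorderType d) : Prop :=
  inhabited I /\ forall i j : I, exists k, (i <= k)%O /\ (j <= k)%O.

Section DirectLimits.
Variables (C : category) (d : Order.disp_t) (I : preorderType d).
Local Open Scope order_scope.

Record direct_system := DirectSystem {
  sys_obj : I -> obj C;
  sys_map : forall i j, i <= j -> mor (sys_obj i) (sys_obj j);
  sys_map1 : forall i (ii : i <= i), sys_map ii = mid (sys_obj i);
  sys_mapM : forall i j k (ij : i <= j) (jk : j <= k) (ik : i <= k),
    mcomp (sys_map jk) (sys_map ij) = sys_map ik }.

Definition compatible (S : direct_system) (E : obj C)
    (phi : forall i, mor (sys_obj S i) E) : Prop :=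
  forall i j (ij : i <= j), mcomp (phi j) (sys_map S ij) = phi i.

Definition is_direct_limit (S : direct_system) (E : obj C)
    (phi : forall i, mor (sys_obj S i) E) : Prop :=
  compatible phi /\
  forall (E' : obj C) (phi' : forall i, mor (sys_obj S i) E'),
    compatible phi' ->
    exists! chi : mor E E', forall i, phi' i = mcomp chi (phi i).

End DirectLimits.

Program Definition map_system (C D : category) (F : functor C D)
    d (I : preorderType d) (S : direct_system C I) : direct_system D I :=
  @DirectSystem D d I (fun i => fobj F (sys_obj S i))
    (fun i j ij => fmap F (sys_map S ij)) _ _.
Next Obligation. by move=> C D F d I S i ii /=; rewrite sys_map1 fmap1. Qed.
Next Obligation.
by move=> C D F d I S i j k ij jk ik /=; rewrite -fmapM (sys_mapM S ij jk ik).
Qed.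

Definition is_direct_limit_under (C D : category) (F : functor C D)
    d (I : preorderType d) (S : direct_system C I) (E : obj C)
    (phi : forall i, mor (sys_obj S i) E) : Prop :=
  is_direct_limit (S := map_system F S) (fun i => fmap F (phi i)).

(* Categories of structured sets: [T] is the underlying set of an object, and
   the morphisms are the maps of underlying sets that satisfy [P]. *)
Section StructuredSets.
Variables (O : Type) (T : O -> Type).
Variable P : forall A B : O, (T A -> T B) -> Prop.
Hypothesis P1 : forall A, P (@id (T A)).
Hypothesis PM : forall A B C (g : T B -> T C) (f : T A -> T B),
  P g -> P f -> P (g \o f).

Program Definition structured_sets : category :=
  @Category O (fun A B => {f : T A -> T B | P f})
    (fun A => exist _ id (P1 A))
    (fun A B C g f => exist _ (sval g \o sval f) (PM (svalP g) (svalP f)))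
    _ _ _.
Next Obligation. by move=> A B f; apply: sval_inj. Qed.
Next Obligation. by move=> A B f; apply: sval_inj. Qed.
Next Obligation. by move=> A B C D h g f; apply: sval_inj. Qed.

End StructuredSets.

Program Definition SET : category :=
  @Category Type (fun A B => A -> B) (fun A => id) (fun A B C g f => g \o f)
    _ _ _.
Next Obligation. by []. Qed.
Next Obligation. by []. Qed.
Next Obligation. by []. Qed.

Section Chain.
Variable R : realType.

Definition VL_IPLH : category :=
  structured_sets (@iplh_id R) (@iplh_comp R).

Definition VL_LH : category :=
  structured_sets (@lattice_hom_id R) (@lattice_hom_comp R).

Definition POVS_Pos : category :=
  structured_sets (@positive_linear_id R) (@positive_linear_comp R).

Definition VS : category :=
  structured_sets (@linear_map_id R) (@linear_map_comp R).

Program Definition IPLH_to_LH : functor VL_IPLH VL_LH :=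
  @Functor VL_IPLH VL_LH id
    (fun A B f => exist _ (sval f) (svalP f).1) _ _.
Next Obligation. by move=> A; apply: sval_inj. Qed.
Next Obligation. by move=> *; apply: sval_inj. Qed.

Program Definition LH_to_POVS : functor VL_LH POVS_Pos :=
  @Functor VL_LH POVS_Pos
    (fun E : vectorLatticeType R => E : preorderedVectType R)
    (fun A B f => exist _ (sval f) (lattice_hom_positive (svalP f))) _ _.
Next Obligation. by move=> A; apply: sval_inj. Qed.
Next Obligation. by move=> *; apply: sval_inj. Qed.

Program Definition POVS_to_VS : functor POVS_Pos VS :=
  @Functor POVS_Pos VS (fun E : preorderedVectType R => E : lmodType R)
    (fun A B f => exist _ (sval f) (svalP f).1) _ _.
Next Obligation. by move=> A; apply: sval_inj. Qed.
Next Obligation. by move=> *; apply: sval_inj. Qed.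

Program Definition VS_to_SET : functor VS SET :=
  @Functor VS SET (fun E : lmodType R => E : Type) (fun A B f => sval f) _ _.
Next Obligation. by []. Qed.
Next Obligation. by []. Qed.

Definition LH_to_VS := comp_functor POVS_to_VS LH_to_POVS.
Definition LH_to_SET := comp_functor VS_to_SET LH_to_VS.
Definition IPLH_to_POVS := comp_functor LH_to_POVS IPLH_to_LH.
Definition IPLH_to_VS := comp_functor LH_to_VS IPLH_to_LH.
Definition IPLH_to_SET := comp_functor LH_to_SET IPLH_to_LH.

End Chain.

(* Main.v *)
(* Call a compatible system of maps phi_i : T_i -> E a concrete limit when the
   phi_i are jointly surjective and two points of T_i with the same image in E
   already agree at a later stage. By directedness, finitely many elements of E
   have representatives at one common stage, so that operations, order and
   identities pass from the T_i to E, and a compatible family of maps out of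
   the T_i induces a map out of E with the same algebraic properties. Hence a
   concrete limit is a direct limit in each of the categories, whatever the
   structure, provided that the phi_i are morphisms of the strongest category
   involved. The quotient of the disjoint union of the T_i is a concrete limit;
   since direct limits are unique up to isomorphism, every direct limit is
   concrete, and is therefore also a direct limit further to the right. *)
From HB Require Import structures.
Require Import Defs.
From mathcomp Require Import all_boot all_order all_algebra.
From mathcomp Require Import boolp classical_sets reals.

Set Implicit Arguments.
Unset Strict Implicit.
Unset Printing Implicit Defensive.

Local Open Scope classical_set_scope.

Import Order.TTheory GRing.Theory Num.Theory.

(** * Concrete limits of directed systems of sets *)

Section ConcreteLimits.
Variables (d : Order.disp_t) (I : preorderType d) (T : I -> Type).
Variable f : forall i j : I, (i <= j)%O -> T i -> T j.

Definition set_system : Prop :=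
  (forall i (ii : (i <= i)%O) x, f ii x = x) /\
  forall i j k (ij : (i <= j)%O) (jk : (j <= k)%O) (ik : (i <= k)%O) x,
    f jk (f ij x) = f ik x.

Definition concrete_limit (E : Type) (phi : forall i, T i -> E) : Prop :=
  [/\ forall i j (ij : (i <= j)%O) x, phi j (f ij x) = phi i x,
      forall e, exists i x, phi i x = e
    & forall i x y, phi i x = phi i y ->
        exists j (ij : (i <= j)%O), f ij x = f ij y].

Hypotheses (I_directed : directed_set I) (fS : set_system).

(** The points of [E] are the equivalence classes for eventual agreement, taken as sets of tagged
    points. Transitivity of this relation rests on directedness. *)
Lemma concrete_limit_exists :
  exists (E : choiceType) (phi : forall i, T i -> E), concrete_limit phi.
Proof.
have [_ fM] := fS.
pose eqv (a : {i & T i}) : set {i & T i} := [set b |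
  exists k (ak : (tag a <= k)%O) (bk : (tag b <= k)%O),
    f ak (tagged a) = f bk (tagged b)].
pose Q := {A : set {i & T i} | exists a, A = eqv a}.
(* The algebraic structures are built over choice types, so the classes receive a classical choice
   structure. *)
pose E : choiceType := HB.pack Q (gen_eqMixin Q) (gen_choiceMixin Q).
pose phi i (x : T i) : E := exist _ (eqv (Tagged T x)) (ex_intro _ _ erefl).
have eqv_sym a b : eqv a b -> eqv b a by move=> [k [p [q e]]]; exists k, q, p.
have eqv_trans a b c : eqv a b -> eqv b c -> eqv a c.
  move=> [k [ak [bk ek]]] [l [bl [cl el]]].
  have [m [km lm]] := I_directed.2 k l.
  exists m, (le_trans ak km), (le_trans cl lm).
  (* Both sides become the image of [b] at stage [m], once through [k] and once through [l]. *)
  by rewrite -(fM _ _ _ ak km) ek -(fM _ _ _ cl lm) -el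
    (fM _ _ _ _ _ (le_trans bk km)) (fM _ _ _ _ _ (le_trans bk km)).
have phiP i j (x : T i) (y : T j) :
    phi i x = phi j y <-> eqv (Tagged T x) (Tagged T y).
  split=> [/(congr1 sval)/= ->|xy].
    by exists j, (lexx j), (lexx j).
  apply: sval_inj => /=; apply/seteqP; split=> c; last exact: eqv_trans.
  exact/eqv_trans/eqv_sym.
exists E, phi; split.
- move=> i j ij x; apply/phiP; exists j, (lexx j), ij => /=.
  exact: fM.
- by move=> [A [[i x] eA]]; exists i, x; apply: sval_inj; rewrite /= eA.
- move=> i x y /phiP[k [/= p [q]]].
  (* [p] and [q] prove the same boolean inequality [i <= k], hence coincide. *)
  by rewrite (bool_irrelevance q p); exists k, p.
Qed.

Variables (E : Type) (phi : forall i, T i -> E).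
Hypothesis phiC : concrete_limit phi.

Lemma common_stage (i j : I) : exists k, (i <= k)%O /\ (j <= k)%O.
Proof. exact: I_directed.2. Qed.

(** Concreteness compares points of a single stage only, so [x] and [y] are first moved to a common
    stage [l]. *)
Lemma eventual_eq i j (x : T i) (y : T j) : phi x = phi y ->
  exists k (ik : (i <= k)%O) (jk : (j <= k)%O), f ik x = f jk y.
Proof.
have [phif _ phi_inj] := phiC; have [_ fM] := fS => xy.
have [l [il jl]] := common_stage i j.
have /phi_inj[k [lk e]] : phi (f il x) = phi (f jl y) by rewrite !phif.
exists k, (le_trans il lk), (le_trans jl lk).
by rewrite -(fM _ _ _ il lk) e; exact: fM.
Qed.

(** The two equalities are obtained at possibly different stages [k] and [l], but both persist at a
    common later stage [m]. *)
Lemma eventual_eq2 i j (x x' : T i) (y y' : T j) :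
  phi x = phi y -> phi x' = phi y' ->
  exists k (ik : (i <= k)%O) (jk : (j <= k)%O),
    f ik x = f jk y /\ f ik x' = f jk y'.
Proof.
have [_ fM] := fS => /eventual_eq[k [ik [jk e]]] /eventual_eq[l [il [jl e']]].
have [m [km lm]] := common_stage k l.
exists m, (le_trans ik km), (le_trans jk km); split.
  by rewrite -(fM _ _ _ ik km) e; exact: fM.
rewrite -(fM _ _ _ il lm) e' (fM _ _ _ _ _ (le_trans jl lm)).
by congr f; exact: bool_irrelevance.
Qed.

Lemma common_rep2 e1 e2 : exists i (x y : T i), phi x = e1 /\ phi y = e2.
Proof.
have [phif phi_surj _] := phiC.
have [[i [x <-]] [j [y <-]]] := (phi_surj e1, phi_surj e2).
have [k [ik jk]] := common_stage i j.
by exists k, (f ik x), (f jk y); rewrite !phif.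
Qed.

Lemma common_rep3 e1 e2 e3 :
  exists i (x y z : T i), [/\ phi x = e1, phi y = e2 & phi z = e3].
Proof.
have [phif phi_surj _] := phiC.
have [[i [x [y [<- <-]]]] [j [z <-]]] := (common_rep2 e1 e2, phi_surj e3).
have [k [ik jk]] := common_stage i j.
by exists k, (f ik x), (f ik y), (f jk z); rewrite !phif.
Qed.

(** Two pairs of representatives of the same pair of points agree simultaneously at a later stage,
    so the value of [h] does not depend on the representatives. *)
Lemma lift2 (U : Type) (h : forall i, T i -> T i -> U) :
  (forall i j (ij : (i <= j)%O) x y, h j (f ij x) (f ij y) = h i x y) ->
  exists H : E -> E -> U, forall i x y, H (phi x) (phi y) = h i x y.
Proof.
move=> hf; suff /choice[H HP] : forall e : E * E, exists u : U,
    forall i x y, phi x = e.1 -> phi y = e.2 -> h i x y = u.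
  by exists (fun e1 e2 => H (e1, e2)) => i x y; rewrite -(HP (_, _) _ x y).
move=> [e1 e2]; have [i [x [y /= [<- <-]]]] := common_rep2 e1 e2.
exists (h i x y) => j x' y' exx' eyy'.
have [k [jk [ik [e e']]]] := eventual_eq2 exx' eyy'.
by rewrite -(hf _ _ jk) e e' hf.
Qed.

Lemma lift1 (U : Type) (h : forall i, T i -> U) :
  (forall i j (ij : (i <= j)%O) x, h j (f ij x) = h i x) ->
  exists H : E -> U, forall i x, H (phi x) = h i x.
Proof.
move=> hf; have [|H HP] := @lift2 U (fun i x _ => h i x); first by move=> *.
by exists (fun e => H e e) => i x; rewrite HP.
Qed.

End ConcreteLimits.

(** * Vector space structure on a concrete limit *)

Section Linear.
Local Open Scope ring_scope.
Variables (R : realType) (d : Order.disp_t) (I : preorderType d).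
Variables (T : I -> lmodType R) (f : forall i j : I, (i <= j)%O -> T i -> T j).
Hypotheses (I_directed : directed_set I) (fS : set_system (@f)).
Hypothesis f_lin : forall i j (ij : (i <= j)%O), linear (f ij).

Lemma linear_add (E F : lmodType R) (g : E -> F) : linear g ->
  {morph g : x y / x + y}.
Proof. by move=> gl x y; have := gl 1 x y; rewrite !scale1r. Qed.

Lemma linear_scale (E F : lmodType R) (g : E -> F) a : linear g ->
  {morph g : x / a *: x}.
Proof. by move=> gl x; have := gl a x 0; rewrite (linear_map0 gl) !addr0. Qed.

Lemma linear_opp (E F : lmodType R) (g : E -> F) : linear g ->
  {morph g : x / - x}.
Proof. by move=> gl x; rewrite -!scaleN1r linear_scale. Qed.

Lemma concrete_limit_lmod : exists (E : lmodType R) (phi : forall i, T i -> E),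
  concrete_limit (@f) phi /\ forall i, linear (phi i).
Proof.
(* [HB.pack] below needs the structure of [Q] in constructor form. *)
have [[Q Qc] [phi phiC]] := concrete_limit_exists I_directed fS.
have [phif phi_surj _] := phiC.
have [[i0] _] := I_directed.
have rep3 := common_rep3 I_directed phiC.
have [|add addE] := @lift2 _ _ _ _ I_directed fS _ _ phiC Q
  (fun i x y => phi i (x + y)).
  by move=> i j ij x y; rewrite -(linear_add (f_lin ij)) phif.
have [|opp oppE] := @lift1 _ _ _ _ I_directed fS _ _ phiC Q
  (fun i x => phi i (- x)).
  by move=> i j ij x; rewrite -(linear_opp (f_lin ij)) phif.
(* One unary lift for each scalar; choice assembles them into an action of [R]. *)
have /choice[scale scaleE] : forall a, exists s : Q -> Q, forall i x,
    s (phi i x) = phi i (a *: x).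
  move=> a; apply: (lift1 I_directed fS phiC) => i j ij x.
  by rewrite -(linear_scale _ (f_lin ij)) phif.
(* The stage [i0] is arbitrary: all zeros have the same image, because the transition maps are
   linear and [I] is directed. *)
pose zero : Q := phi i0 0.
have zeroE i : zero = phi i 0.
  have [k [ik jk]] := common_stage I_directed i0 i.
  by rewrite /zero -(phif _ _ ik) -(phif _ _ jk) !linear_map0.
have addA : associative add.
  by move=> a b c; have [i [x [y [z [<- <- <-]]]]] := rep3 a b c;
    rewrite !addE addrA.
have addC : commutative add.
  by move=> a b; have [i [x [y [_ [<- <- _]]]]] := rep3 a b b;
    rewrite !addE addrC.
have add0 : left_id zero add.
  by move=> a; have [i [x <-]] := phi_surj a; rewrite (zeroE i) addE add0r.
have addN : left_inverse zero opp add.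
  by move=> a; have [i [x <-]] := phi_surj a; rewrite oppE addE addNr -zeroE.
pose Z : zmodType := HB.pack Q Qc
  (GRing.isZmodule.Build (Choice.Pack Qc) addA addC add0 addN).
have scaleA a b (v : Z) : scale a (scale b v) = scale (a * b) v.
  by have [i [x <-]] := phi_surj v; rewrite !scaleE scalerA.
have scale1 : left_id 1 (scale : R -> Z -> Z).
  by move=> v; have [i [x <-]] := phi_surj v; rewrite scaleE scale1r.
have scaleDr : right_distributive (scale : R -> Z -> Z) +%R.
  move=> a u v; have [i [x [y [_ [<- <- _]]]]] := rep3 u v v.
  by rewrite /GRing.add/= !scaleE !addE scaleE scalerDr.
have scaleDl (v : Z) : {morph (scale : R -> Z -> Z)^~ v : a b / a + b}.
  move=> a b; have [i [x <-]] := phi_surj v.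
  by rewrite !scaleE scalerDl -addE.
pose E : lmodType R := HB.pack (GRing.Zmodule.sort Z)
  (GRing.Zmodule_isLmodule.Build R Z scaleA scale1 scaleDr scaleDl).
exists E, phi; split=> // i a x y.
by rewrite -addE -scaleE.
Qed.

(** Linearity involves two points at a time, and these have representatives at one stage, where
    [phi i] and [psi i] are linear. *)
Lemma lift_linear (E F : lmodType R) (phi : forall i, T i -> E)
    (psi : forall i, T i -> F) (chi : E -> F) :
  concrete_limit (@f) phi ->
  (forall i, linear (phi i)) -> (forall i, linear (psi i)) ->
  (forall i x, chi (phi i x) = psi i x) -> linear chi.
Proof.
move=> phiC phiL psiL chiE a e1 e2.
have [i [x [y [<- <-]]]] := common_rep2 I_directed phiC e1 e2.
by rewrite -phiL !chiE psiL.
Qed.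

Lemma linear_range (E F : lmodType R) (g : E -> F) :
  linear g -> linear_subspace (range g).
Proof.
move=> gl; split; first by rewrite inE; exists 0 => //; exact: linear_map0.
move=> a x y; rewrite !inE => -[u _ <-] [v _ <-].
by exists (a *: u + v) => //; rewrite gl.
Qed.

End Linear.

(** * Vector lattice structure on a concrete limit *)

Section Lattices.
Local Open Scope ring_scope.
Variables (R : realType) (d : Order.disp_t) (I : preorderType d).
Variable T : I -> vectorLatticeType R.
Variable f : forall i j : I, (i <= j)%O -> T i -> T j.
Hypotheses (I_directed : directed_set I) (fS : set_system (@f)).
Hypothesis f_hom : forall i j (ij : (i <= j)%O), lattice_hom (f ij).

Lemma lattice_hom_le (E F : vectorLatticeType R) (g : E -> F) :
  lattice_hom g -> {homo g : x y / x <= y}.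
Proof. by move=> [_ _ gj] x y; rewrite !leEjoin => /eqP xy; rewrite -gj xy. Qed.

Lemma concrete_limit_vectorLattice :
  exists (E : vectorLatticeType R) (phi : forall i, T i -> E),
  concrete_limit (@f) phi /\ forall i, lattice_hom (phi i).
Proof.
have f_lin i j (ij : (i <= j)%O) : linear (f ij) by have [] := f_hom ij.
have [Q [phi [phiC phiL]]] := concrete_limit_lmod I_directed fS f_lin.
have [phif phi_surj _] := phiC.
have [_ fM] := fS.
have rep3 := common_rep3 I_directed phiC.
(* An inequality in the limit is witnessed by ordered representatives at some stage, and is
   reflected into a boolean relation as the order structures require. *)
have [le leP] : exists le : rel Q, forall a b, le a b <->
    exists i (x y : T i), [/\ phi i x = a, phi i y = b & x <= y].
  exists (fun a b => `[< exists i (x y : T i),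
    [/\ phi i x = a, phi i y = b & x <= y] >]) => a b.
  by split=> /asboolP.
have leI i (x y : T i) : x <= y -> le (phi i x) (phi i y).
  by move=> xy; apply/leP; exists i, x, y.
(* The ordered witnesses may live at another stage. Where they meet the images of [x] and [y],
   monotonicity of the transition map carries the inequality over. *)
have leE i (x y : T i) : le (phi i x) (phi i y) ->
    exists k (ik : (i <= k)%O), f ik x <= f ik y.
  move=> /leP[j [u [v [ux vy uv]]]].
  have [k [jk [ik [xk yk]]]] := eventual_eq2 I_directed fS phiC ux vy.
  by exists k, ik; rewrite -xk -yk; exact: lattice_hom_le.
have leE2 i (x y x' y' : T i) :
    le (phi i x) (phi i y) -> le (phi i x') (phi i y') ->
    exists k (ik : (i <= k)%O), f ik x <= f ik y /\ f ik x' <= f ik y'.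
  move=> /leE[j [ij xy]] /leE[k [ik xy']].
  have [l [jl kl]] := common_stage I_directed j k.
  exists l, (le_trans ij jl); split.
    by rewrite -!(fM _ _ _ ij jl); exact: lattice_hom_le.
  (* The stage [l] is reached through [j] and through [k]; the two resulting proofs of [i <= l] are
     identified so that one transition map serves both inequalities. *)
  rewrite (bool_irrelevance (le_trans ij jl) (le_trans ik kl)).
  by rewrite -!(fM _ _ _ ik kl); exact: lattice_hom_le.
have [|meet meetE] := @lift2 _ _ _ _ I_directed fS _ _ phiC Q
  (fun i x y => phi i (Order.meet x y)).
  by move=> i j ij x y; have [_ <- _] := f_hom ij; rewrite phif.
have [|join joinE] := @lift2 _ _ _ _ I_directed fS _ _ phiC Q
  (fun i x y => phi i (Order.join x y)).
  by move=> i j ij x y; have [_ _ <-] := f_hom ij; rewrite phif.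
have le_refl : reflexive le.
  by move=> a; have [i [x <-]] := phi_surj a; exact: (leI i).
have le_trans : transitive le.
  move=> b a c; have [i [x [y [z [<- <- <-]]]]] := rep3 a b c.
  move=> xy /(leE2 _ _ _ _ _ xy)[k [ik [{}xy yz]]].
  by rewrite -!(phif _ _ ik); apply: (leI k); exact: le_trans xy yz.
have le_add c a b : le a b -> le (a + c) (b + c).
  have [i [x [y [z [<- <- <-]]]]] := rep3 a b c => /leE[k [ik xy]].
  rewrite -!(phif _ _ ik) -!(linear_add (phiL k)); apply: (leI k).
  exact: lev_wD2r.
have le_scale (r : R) a b : 0 <= r -> le a b -> le (r *: a) (r *: b).
  have [i [x [y [_ [<- <- _]]]]] := rep3 a b b => r0 /leE[k [ik xy]].
  rewrite -!(phif _ _ ik) -!(linear_scale _ (phiL k)); apply: (leI k).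
  exact: lev_wZ2l.
have le_anti : antisymmetric le.
  move=> a b; have [i [x [y [_ [<- <- _]]]]] := rep3 a b b.
  move=> /andP[xy /(leE2 _ _ _ _ _ xy)[k [ik [{}xy yx]]]].
  by rewrite -!(phif _ _ ik); congr phi; apply/le_anti; rewrite xy.
have le_meet a b c : le a (meet b c) = le a b && le a c.
  have [i [x [y [z [<- <- <-]]]]] := rep3 a b c; rewrite meetE.
  apply/idP/andP => [xyz|[xy /(leE2 _ _ _ _ _ xy)[k [ik [{}xy xz]]]]].
    by split; apply: (le_trans _ _ _ xyz); apply: (leI i);
      [exact: leIl | exact: leIr].
  (* Both inequalities now hold at stage [k], and [f ik] sends the meet to the meet of the
     images. *)
  rewrite -(phif _ _ ik x) -(phif _ _ ik (Order.meet y z)); apply: (leI k).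
  by have [_ -> _] := f_hom ik; rewrite lexI xy.
have le_join a b c : le (join a b) c = le a c && le b c.
  have [i [x [y [z [<- <- <-]]]]] := rep3 a b c; rewrite joinE.
  apply/idP/andP => [xyz|[xz /(leE2 _ _ _ _ _ xz)[k [ik [{}xz yz]]]]].
    by split; apply: (le_trans _ _ _ _ xyz); apply: (leI i);
      [exact: leUl | exact: leUr].
  rewrite -(phif _ _ ik z) -(phif _ _ ik (Order.join x y)); apply: (leI k).
  by have [_ _ ->] := f_hom ik; rewrite leUx xz.
pose P : preorderedVectType R := HB.pack (GRing.Lmodule.sort Q)
  (Lmodule_isPreordered.Build R Q le_refl le_trans le_add le_scale).
pose E : vectorLatticeType R := HB.pack (PreorderedVect.sort P)
  (PreorderedVect_isLattice.Build R P le_anti le_meet le_join).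
exists E, phi; split=> // i; split; first exact: phiL.
- by move=> x y; exact: esym (meetE _ _ _).
- by move=> x y; exact: esym (joinE _ _ _).
Qed.

Section Lift.
Variables (E : vectorLatticeType R) (phi : forall i, T i -> E).
Hypothesis phiC : concrete_limit (@f) phi.
Hypothesis phi_hom : forall i, lattice_hom (@phi i).

Lemma lift_lattice_hom (F : vectorLatticeType R) (psi : forall i, T i -> F)
    (chi : E -> F) :
  (forall i, lattice_hom (psi i)) ->
  (forall i x, chi (@phi i x) = psi i x) -> lattice_hom chi.
Proof.
move=> psi_hom chiE; split.
- apply: (lift_linear I_directed phiC) chiE => i.
  + by have [] := phi_hom i.
  + by have [] := psi_hom i.
- move=> e1 e2; have [i [x [y [<- <-]]]] := common_rep2 I_directed phiC e1 e2.
  have [_ phiM _] := phi_hom i; have [_ psiM _] := psi_hom i.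
  by rewrite -phiM !chiE psiM.
- move=> e1 e2; have [i [x [y [<- <-]]]] := common_rep2 I_directed phiC e1 e2.
  have [_ _ phiJ] := phi_hom i; have [_ _ psiJ] := psi_hom i.
  by rewrite -phiJ !chiE psiJ.
Qed.

(** A representative [x] of [e] need not be positive itself, but its join with 0 is, and it has the
    same image because [e] is positive. *)
Lemma nonneg_rep (e : E) : 0 <= e -> exists i (x : T i), 0 <= x /\ @phi i x = e.
Proof.
have [_ phi_surj _] := phiC; have [i [x <-]] := phi_surj e => x0.
exists i, (Order.join (0 : T i) x); split; first exact: leUl.
have [phiL _ ->] := phi_hom i.
by rewrite (linear_map0 phiL); exact/join_r.
Qed.

Lemma lift_positive (F : preorderedVectType R) (psi : forall i, T i -> F)
    (chi : E -> F) :
  (forall i, positive_linear (psi i)) ->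
  (forall i x, chi (@phi i x) = psi i x) -> positive_linear chi.
Proof.
move=> psi_pos chiE; split.
  apply: (lift_linear I_directed phiC) chiE => i.
  + by have [] := phi_hom i.
  + by have [] := psi_pos i.
move=> e /nonneg_rep[i [x [x0 <-]]].
by rewrite chiE; exact: (psi_pos i).2.
Qed.

(** For the inclusion that is not mere monotonicity, a positive [e] is written as [phi x] with [x]
    positive. A point below [chi e] then comes from [[0, x]] through [psi i], and its preimage is
    pushed into [E] by [phi i]. *)
Lemma lift_iplh (F : vectorLatticeType R) (psi : forall i, T i -> F)
    (chi : E -> F) :
  (forall i, iplh (psi i)) ->
  (forall i x, chi (@phi i x) = psi i x) -> iplh chi.
Proof.
move=> psi_iplh chiE.
have chi_hom : lattice_hom chi.
  by apply: lift_lattice_hom chiE => i; have [] := psi_iplh i.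
have chi_pos := lattice_hom_positive chi_hom.
split=> //; split=> // _ /nonneg_rep[i [x [x0 <-]]].
apply/seteqP; split=> [_ [u + <-]|v].
  rewrite /= !in_itv/= => /andP[u0 ux].
  by rewrite chi_pos.2//=; exact: lattice_hom_le.
rewrite chiE; have [_ [_ <-//]] := psi_iplh i => -[u + <-].
rewrite /= in_itv/= => /andP[u0 ux].
exists (@phi i u); last by rewrite chiE.
rewrite /= in_itv/= (lattice_hom_positive (phi_hom i)).2//=.
exact: lattice_hom_le.
Qed.

(** A point of [[0, phi x]] is represented at a stage [k] beyond [i], and is pulled back to [[0, x]]
    along the interval preserving map [f ik]. *)
Lemma concrete_limit_iplh : (forall i j (ij : (i <= j)%O), iplh (f ij)) ->
  forall i, iplh (@phi i).
Proof.
move=> f_iplh i; have phi_pos j := lattice_hom_positive (phi_hom j).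
split=> //; split=> // x x0; have [phif phi_surj _] := phiC.
apply/seteqP; split=> [_ [u + <-]|e].
  rewrite /= !in_itv/= => /andP[u0 ux].
  by rewrite (phi_pos i).2//=; exact: lattice_hom_le.
rewrite /= in_itv/=; have [j [y <-]] := phi_surj e => /andP[y0 yx].
have [k [ik jk]] := common_stage I_directed i j.
have fx0 : 0 <= f ik x by apply: (lattice_hom_positive (f_hom ik)).2.
(* Truncating [f jk y] to the interval does not change its image, and makes
   interval preservation of [f ik] applicable. *)
pose z := Order.meet (Order.join (0 : T k) (f jk y)) (f ik x).
have : z \in `[0, f ik x] by rewrite in_itv/= lexI leUl fx0 leIr.
have [_ [_ /(_ x x0)/seteqP[_ sub]]] := f_iplh _ _ ik.
move=> /sub[u u0x uz]; exists u => //.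
have [phiL phiM phiJ] := phi_hom k.
rewrite -(phif _ _ ik u) uz phiM phiJ !phif (linear_map0 phiL).
by rewrite (join_r y0) (meet_l yx).
Qed.

End Lift.

Lemma sublattice_range (E F : vectorLatticeType R) (g : E -> F) :
  lattice_hom g -> vector_sublattice (range g).
Proof.
move=> [gL gM gJ]; split; first exact: linear_range.
- move=> x y; rewrite !inE => -[u _ <-] [v _ <-].
  by exists (Order.meet u v) => //; rewrite gM.
- move=> x y; rewrite !inE => -[u _ <-] [v _ <-].
  by exists (Order.join u v) => //; rewrite gJ.
Qed.

End Lattices.

(** * Ranges of interval preserving lattice homomorphisms are ideals *)

Section Ideals.
Variables (R : realType).
Local Open Scope ring_scope.

Lemma vl_leD2r (E : preorderedVectType R) (z x y : E) :
  (x + z <= y + z) = (x <= y).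
Proof.
apply/idP/idP => [/(lev_wD2r (- z))|]; last exact: lev_wD2r.
by rewrite !addrK.
Qed.

(** Adding the inequalities of [x] and [- x] with [m] gives that [m + m] is positive; scaling by one
    half concludes. *)
Lemma vl_modulus_ge0 (E : vectorLatticeType R) (x : E) : 0 <= vl_modulus x.
Proof.
set m := vl_modulus x.
have xm : x <= m by exact: leUl.
have xNm : - x <= m by exact: leUr.
have mm : 0 <= m + m.
  apply: (@le_trans _ _ (m + x)).
    by rewrite -(vl_leD2r (- x)) add0r addrK.
  by rewrite ![m + _]addrC vl_leD2r.
have h : (0 : R) <= 2^-1 by rewrite invr_ge0 ler0n.
have := lev_wZ2l _ _ _ h mm; rewrite scaler0 => /le_trans; apply.
by rewrite -mulr2n -scaler_nat scalerA mulVf ?scale1r ?pnatr_eq0.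
Qed.

Lemma lattice_hom_modulus (E F : vectorLatticeType R) (g : E -> F) x :
  lattice_hom g -> g (vl_modulus x) = vl_modulus (g x).
Proof. by move=> [gL _ gJ]; rewrite /vl_modulus gJ (linear_opp gL). Qed.

(** If the modulus of [x] lies below that of [g u], which is [g] of the modulus of [u], then
    interval preservation puts every point between 0 and the modulus of [x] in the range. This
    covers the positive and negative parts of [x], and [x] is their difference. *)
Lemma ideal_range (E F : vectorLatticeType R) (g : E -> F) :
  iplh g -> lattice_ideal (range g).
Proof.
move=> [g_hom [_ g_ip]]; have [gL _ _] := g_hom.
split; first exact: linear_range.
move=> x _ [u _ <-]; rewrite -lattice_hom_modulus// => xu.
have u0 := vl_modulus_ge0 u; set m := vl_modulus u in xu u0.
have in_range z : 0 <= z -> z <= vl_modulus x -> range g z.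
  move=> z0 zx; have /seteqP[_ /(_ z)[]] := g_ip m u0.
    by rewrite /= in_itv/= z0 (le_trans zx).
  by move=> v _ <-; exists v.
(* [p] and [p - x] are the positive and the negative part of [x]. *)
pose p := Order.join (0 : F) x.
have [v _ vp] : range g p.
  apply: in_range; first exact: leUl.
  by rewrite leUx vl_modulus_ge0 leUl.
have [w _ wp] : range g (p - x).
  apply: in_range; rewrite -(vl_leD2r x) subrK; first by rewrite add0r leUr.
  (* The bound on [p - x] has become [p <= vl_modulus x + x], which splits into
     [- x <= vl_modulus x] and [0 <= vl_modulus x]. *)
  rewrite leUx -[X in _ && X](vl_leD2r (- x)) addrK subrr vl_modulus_ge0 andbT.
  by rewrite -(vl_leD2r (- x)) addrK add0r; exact: leUr.
exists (v - w) => //.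
by rewrite (linear_add gL) (linear_opp gL) vp wp opprB addrC subrK.
Qed.

End Ideals.

(** * Concrete limits and direct limits in categories of structured sets *)

Section StructuredLimits.
Variables (O : Type) (X : O -> Type) (P : forall A B : O, (X A -> X B) -> Prop).
Hypothesis P1 : forall A, P (@id (X A)).
Hypothesis PM : forall A B C (g : X B -> X C) (f : X A -> X B),
  P g -> P f -> P (g \o f).
Variables (d : Order.disp_t) (I : preorderType d).
Let C := structured_sets P1 PM.
Variable S : direct_system C I.

Definition underlying (i j : I) (ij : (i <= j)%O) :
  X (sys_obj S i) -> X (sys_obj S j) := sval (sys_map S ij).

Lemma underlying_system : set_system underlying.
Proof.
split=> [i ii x|i j k ij jk ik x].
- by rewrite /underlying sys_map1.
- by rewrite /underlying -(sys_mapM S ij jk ik).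
Qed.

Hypothesis I_directed : directed_set I.

(** The set-theoretic lift gives the mediating map, and joint surjectivity its uniqueness. What
    depends on the category is isolated in the second premise: the induced map is a morphism. *)
Lemma concrete_direct_limit (E : O)
    (phi : forall i, mor (sys_obj S i) (E : obj C)) :
  concrete_limit underlying (fun i => sval (phi i)) ->
  (forall (F : O) (psi : forall i, mor (sys_obj S i) (F : obj C))
      (chi : X E -> X F),
    (forall i x, chi (sval (phi i) x) = sval (psi i) x) -> P chi) ->
  is_direct_limit phi.
Proof.
move=> phiC lift; have [phif phi_surj _] := phiC; split.
  by move=> i j ij; apply: sval_inj; apply/funext => x; exact: phif.
move=> F psi psif.
have [|chi chiE] := lift1 I_directed underlying_system phiC
    (h := fun i => sval (psi i)).
  by move=> i j ij x; rewrite -(psif _ _ ij).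
exists (exist _ chi (lift _ _ _ chiE)); split.
  by move=> i; apply: sval_inj; apply/funext => x /=; rewrite chiE.
move=> chi' chi'E; apply: sval_inj; apply/funext => e.
by have [i [x <-]] := phi_surj e; rewrite /= chiE chi'E.
Qed.

(** The universal properties give comparison maps [g] and [h] with [h] after [g] the identity.
    Surjectivity is transported along [h], and eventual equality is reflected through [g]. *)
Lemma direct_limit_concrete (E F : O)
    (phi : forall i, mor (sys_obj S i) (E : obj C))
    (psi : forall i, mor (sys_obj S i) (F : obj C)) :
  is_direct_limit psi -> concrete_limit underlying (fun i => sval (psi i)) ->
  is_direct_limit phi -> concrete_limit underlying (fun i => sval (phi i)).
Proof.
move=> [psif psiU] [_ psi_surj psi_inj] [phif phiU].
have [g [gE _]] := phiU F psi psif.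
have [h [hE _]] := psiU E phi phif.
have [k [_ k_uniq]] := phiU E phi phif.
(* Both sides are endomorphisms of [E] compatible with [phi], so each equals the unique one, [k]. *)
have hg1 : mcomp h g = mid (E : obj C).
  rewrite -(k_uniq (mid _)) => [|i]; last by rewrite mcomp1m.
  by apply/esym/k_uniq => i; rewrite -mcompA -gE.
have hgK e : sval h (sval g e) = e by exact: (congr1 (fun m => sval m e) hg1).
split.
- by move=> i j ij x; rewrite -(phif _ _ ij).
- move=> e; have [i [x xe]] := psi_surj (sval g e).
  by exists i, x; rewrite hE /= xe.
- by move=> i x y xy; apply: psi_inj; rewrite gE /= xy.
Qed.

Lemma concrete_union (E : O) (phi : forall i, mor (sys_obj S i) (E : obj C)) :
  concrete_limit underlying (fun i => sval (phi i)) ->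
  [set: X E] = \bigcup_(i in [set: I]) range (sval (phi i)) /\
  forall i j : I, (i <= j)%O -> range (sval (phi i)) `<=` range (sval (phi j)).
Proof.
move=> [phif phi_surj _]; split.
  apply/seteqP; split=> // e _; have [i [x <-]] := phi_surj e.
  by exists i => //; exists x.
by move=> i j ij _ [x _ <-]; rewrite -(phif _ _ ij); exists (underlying ij x).
Qed.

End StructuredLimits.
Arguments underlying {O X P P1 PM d I} S i j ij x.

(** Morphisms of [SET] are bare functions rather than functions paired with a proof, whence a
    separate version, in which every lift is a morphism. *)
Lemma concrete_direct_limit_SET d (I : preorderType d) (S : direct_system SET I)
    (E : Type) (phi : forall i, mor (sys_obj S i) (E : obj SET)) :
  directed_set I -> concrete_limit (sys_map S) phi -> is_direct_limit phi.
Proof.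
move=> I_directed phiC; have [phif phi_surj _] := phiC; split.
  by move=> i j ij; apply/funext => x; exact: phif.
have S_sys : set_system (sys_map S).
  split=> [i ii x|i j k ij jk ik x]; first by rewrite sys_map1.
  by rewrite -(sys_mapM S ij jk ik).
move=> F psi psif.
have [|chi chiE] := lift1 I_directed S_sys phiC (h := psi).
  by move=> i j ij x; rewrite -(psif _ _ ij).
exists chi; split; first by move=> i; apply/funext => x /=; rewrite chiE.
move=> chi' chi'E; apply/funext => e.
by have [i [x <-]] := phi_surj e; rewrite /= chiE chi'E.
Qed.

(** * Concrete limits are direct limits throughout the chain *)

Section Limits.
Variables (R : realType) (d : Order.disp_t) (I : preorderType d).
Hypothesis I_directed : directed_set I.

Lemma VS_limit (S : direct_system (VS R) I) (E : lmodType R)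
    (phi : forall i, mor (sys_obj S i) (E : obj (VS R))) :
  concrete_limit (underlying S) (fun i => sval (phi i)) -> is_direct_limit phi.
Proof.
move=> phiC; apply: concrete_direct_limit => // F psi chi.
by apply: (lift_linear I_directed phiC) => i;
  [exact: svalP (phi i) | exact: svalP (psi i)].
Qed.

(** The forgetful functors keep the underlying maps, so [phiC] applies by conversion in each of the
    four categories; only the lifting argument changes. *)
Lemma LH_limit (S : direct_system (VL_LH R) I) (E : vectorLatticeType R)
    (phi : forall i, mor (sys_obj S i) (E : obj (VL_LH R))) :
  concrete_limit (underlying S) (fun i => sval (phi i)) ->
  [/\ is_direct_limit phi, is_direct_limit_under (LH_to_POVS R) phi,
      is_direct_limit_under (LH_to_VS R) phi
    & is_direct_limit_under (LH_to_SET R) phi].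
Proof.
move=> phiC; have phi_hom i : lattice_hom (sval (phi i)) := svalP (phi i).
split.
- apply: concrete_direct_limit => // F psi chi.
  by apply: (lift_lattice_hom I_directed phiC) => // i; exact: svalP (psi i).
- apply: concrete_direct_limit => // F psi chi.
  by apply: (lift_positive I_directed phiC) => // i; exact: svalP (psi i).
- exact: (@VS_limit (map_system (LH_to_VS R) S)).
- exact: (@concrete_direct_limit_SET _ _ (map_system (LH_to_SET R) S)).
Qed.

Lemma IPLH_limit (S : direct_system (VL_IPLH R) I) (E : vectorLatticeType R)
    (phi : forall i, mor (sys_obj S i) (E : obj (VL_IPLH R))) :
  concrete_limit (underlying S) (fun i => sval (phi i)) -> is_direct_limit phi.
Proof.
move=> phiC; apply: concrete_direct_limit => // F psi chi.
apply: (lift_iplh I_directed phiC) => i; last exact: svalP (psi i).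
by have [] := svalP (phi i).
Qed.

End Limits.

Theorem theorem4p1 (R : realType) (d : Order.disp_t) (I : preorderType d)
    (I_directed : directed_set I) :
  [/\ forall S : direct_system (VL_IPLH R) I,
        (exists (E : vectorLatticeType R)
            (phi : forall i, mor (sys_obj S i) (E : obj (VL_IPLH R))),
          is_direct_limit phi) /\
        forall (E : vectorLatticeType R)
            (phi : forall i, mor (sys_obj S i) (E : obj (VL_IPLH R))),
          is_direct_limit phi ->
          [/\ [set: E] = \bigcup_(i in [set: I]) range (sval (phi i)),
              forall i j : I, (i <= j)%O ->
                range (sval (phi i)) `<=` range (sval (phi j)),
              forall i, lattice_ideal (E := E) (range (sval (phi i)))
            & [/\ is_direct_limit_under (IPLH_to_LH R) phi,
                  is_direct_limit_under (IPLH_to_POVS R) phi,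
                  is_direct_limit_under (IPLH_to_VS R) phi
                & is_direct_limit_under (IPLH_to_SET R) phi]],
      forall S : direct_system (VL_LH R) I,
        (exists (E : vectorLatticeType R)
            (phi : forall i, mor (sys_obj S i) (E : obj (VL_LH R))),
          is_direct_limit phi) /\
        forall (E : vectorLatticeType R)
            (phi : forall i, mor (sys_obj S i) (E : obj (VL_LH R))),
          is_direct_limit phi ->
          [/\ [set: E] = \bigcup_(i in [set: I]) range (sval (phi i)),
              forall i j : I, (i <= j)%O ->
                range (sval (phi i)) `<=` range (sval (phi j)),
              forall i, vector_sublattice (E := E) (range (sval (phi i)))
            & [/\ is_direct_limit_under (LH_to_POVS R) phi,
                  is_direct_limit_under (LH_to_VS R) phi
                & is_direct_limit_under (LH_to_SET R) phi]]
    & forall S : direct_system (VS R) I,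
        (exists (E : lmodType R)
            (phi : forall i, mor (sys_obj S i) (E : obj (VS R))),
          is_direct_limit phi) /\
        forall (E : lmodType R)
            (phi : forall i, mor (sys_obj S i) (E : obj (VS R))),
          is_direct_limit phi ->
          [/\ [set: E] = \bigcup_(i in [set: I]) range (sval (phi i)),
              forall i j : I, (i <= j)%O ->
                range (sval (phi i)) `<=` range (sval (phi j)),
              forall i, linear_subspace (E := E) (range (sval (phi i)))
            & is_direct_limit_under (VS_to_SET R) phi]].
Proof.
split=> S.
- have S_sys := underlying_system S.
  have f_iplh i j (ij : (i <= j)%O) : iplh (underlying S i j ij) :=
    svalP (sys_map S ij).
  have f_hom i j (ij : (i <= j)%O) : lattice_hom (underlying S i j ij).
    by have [] := f_iplh _ _ ij.
  have [Q [psi [psiC psi_hom]]] :=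
    concrete_limit_vectorLattice I_directed S_sys f_hom.
  (* The limit is constructed from lattice homomorphisms alone; its maps turn out to be interval
     preserving, hence morphisms of [VL_IPLH]. *)
  have psi_iplh := concrete_limit_iplh I_directed f_hom psiC psi_hom f_iplh.
  pose psi' i : mor (sys_obj S i) (Q : obj (VL_IPLH R)) :=
    exist _ (psi i) (psi_iplh i).
  have psi'L : is_direct_limit psi' by exact: IPLH_limit.
  split=> [|E phi phiL]; first by exists Q, psi'.
  have phiC := direct_limit_concrete psi'L psiC phiL.
  have [E_union E_incr] := concrete_union phiC.
  split=> // [i|]; first exact: ideal_range (svalP (phi i)).
  (* The image of the system in [VL_LH] has the same underlying maps, so its concrete limit settles
     all four categories to the right. *)
  by have [] := @LH_limit _ _ _ I_directed (map_system (IPLH_to_LH R) S) E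
    (fun i => fmap (IPLH_to_LH R) (phi i)) phiC.
- have S_sys := underlying_system S.
  have f_hom i j (ij : (i <= j)%O) : lattice_hom (underlying S i j ij) :=
    svalP (sys_map S ij).
  have [Q [psi [psiC psi_hom]]] :=
    concrete_limit_vectorLattice I_directed S_sys f_hom.
  pose psi' i : mor (sys_obj S i) (Q : obj (VL_LH R)) :=
    exist _ (psi i) (psi_hom i).
  have [psi'L _ _ _] := LH_limit I_directed (phi := psi') psiC.
  split=> [|E phi phiL]; first by exists Q, psi'.
  have phiC := direct_limit_concrete psi'L psiC phiL.
  have [E_union E_incr] := concrete_union phiC.
  split=> // [i|]; first exact: sublattice_range (svalP (phi i)).
  by have [] := LH_limit I_directed phiC.
- have S_sys := underlying_system S.
  have f_lin i j (ij : (i <= j)%O) : linear (underlying S i j ij) :=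
    svalP (sys_map S ij).
  have [Q [psi [psiC psi_lin]]] := concrete_limit_lmod I_directed S_sys f_lin.
  pose psi' i : mor (sys_obj S i) (Q : obj (VS R)) :=
    exist _ (psi i) (psi_lin i).
  have psi'L : is_direct_limit psi' by exact: VS_limit.
  split=> [|E phi phiL]; first by exists Q, psi'.
  have phiC := direct_limit_concrete psi'L psiC phiL.
  have [E_union E_incr] := concrete_union phiC.
  split=> // [i|]; first exact: linear_range (svalP (phi i)).
  exact: (@concrete_direct_limit_SET _ _ (map_system (VS_to_SET R) S)).
Qed.
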